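(* For each $m,n\ge 1$ the posets $\mathcal P_{m+n-2}=(lT_{m+n-1},<)$ (up-rooted trees with levels and $m+n-1$ leaves) and $\mathcal P^n_m=(lT^n_m,<)$ (complementary pairs of trees with levels, with $m$ leaves below and $n$ leaves above) are naturally isomorphic.
   Context: **Trees.** A planar directed (rooted) tree is a planar tree with a specified leg called the root; the remaining legs are the leaves. All vertices have at least three adjacent edges. The exceptional tree has one edge and no vertices; it is the unique tree with one leaf. An up-rooted tree is drawn with the root at the top and the leaves at the bottom, and its edges are oriented towards the root. A down-rooted tree is drawn with the root at the bottom and the leaves at the top, and its edges are oriented away from the root. So in both cases all edges point upwards. $\mathrm{Vert}(T)$ is the set of vertices of $T$. For distinct $v',v''\in \mathrm{Vert}(T)$ write $v'\prec v''$ if there is an oriented edge path starting at $v''$ and ending at $v'$ (so $v'$ is above $v''$). A map of planar trees is a sequence of contractions of internal edges (the root and the leaves are fixed); it induces a map on vertices denoted by the same symbol. **Trees with levels.** For $m\ge 1$, $lT_m$ is the set of pairs $(U,\ell)$ where $U$ is an up-rooted planar tree with $m$ leaves and $\ell:\mathrm{Vert}(U)\to\{1,\dots,h\}$ is a surjection (for some $h\geq 0$) such that $v'\prec v''$ implies $\ell(v')<\ell(v'')$. (Levels are numbered from the top down; $lT_1$ consists of the exceptional tree only.) A morphism $(U',\ell')\to(U'',\ell'')$ is a pair $(\phi,\hat\phi)$ of a map of planar trees $\phi:U'\to U''$ and an order-preserving map $\hat\phi:\{1,\dots,h'\}\to\{1,\dots,h''\}$ such that $\ell''\circ\phi=\hat\phi\circ\ell'$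 on $\mathrm{Vert}(U')$. The partial order is: $(U',\ell')<(U'',\ell'')$ if there is a morphism $(U',\ell')\to(U'',\ell'')$ (reflexive convention). **Complementary pairs.** For $m,n\ge 1$, $lT^n_m$ is the set of triples $(U,D,\ell)$ where $U$ is an up-rooted planar tree with $m$ leaves, $D$ is a down-rooted planar tree with $n$ leaves, and $\ell:\mathrm{Vert}(U)\sqcup \mathrm{Vert}(D)\to\{1,\dots,h\}$ is a surjection (for some $h\ge0$) such that $v'\prec v''$ (both in $U$ or both in $D$) implies $\ell(v')<\ell(v'')$. A morphism $(U',D',\ell')\to(U'',D'',\ell'')$ is a triple $(\phi_u,\phi_d,\hat\phi)$ of maps of planar trees $\phi_u:U'\to U''$, $\phi_d:D'\to D''$ and an order-preserving map $\hat\phi:\{1,\dots,h'\}\to\{1,\dots,h''\}$ with $\ell''\circ(\phi_u\sqcup\phi_d)=\hat\phi\circ\ell'$. The partial order is given by $X'<X''$ if there is a morphism $X'\to X''$. *)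

(* Defs.v *)
From HB Require Import structures.
From mathcomp Require Import all_boot all_order.
From mathcomp Require Import zify boolp.

Set Implicit Arguments.
Unset Strict Implicit.
Unset Printing Implicit Defensive.

Import Order.TTheory.

(* The list of children of a vertex is read from left to right.  [Leaf] is
   the exceptional tree when it stands alone.  The root leg and the
   orientation (up- or down-rooted) are not part of the data: the orientation
   only enters through [up_prec] and [down_prec] below. *)
Inductive tree := Leaf | Node of seq tree.

Fixpoint tree_encode (t : tree) : GenTree.tree unit :=
  if t is Node s then GenTree.Node 0 (map tree_encode s) else GenTree.Leaf tt.

Fixpoint tree_decode (t : GenTree.tree unit) : tree :=
  if t is GenTree.Node _ s then Node (map tree_decode s) else Leaf.

Lemma tree_encodeK : cancel tree_encode tree_decode.
Proof.
rewrite /cancel; fix IH 1; case=> [|s]; first exact: erefl.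
rewrite /=; congr Node; elim: s => [|t s IHs]; [exact: erefl | by rewrite /= IH IHs].
Qed.

HB.instance Definition _ := Countable.copy tree (can_type tree_encodeK).

Definition children (t : tree) : seq tree := if t is Node s then s else [::].

Fixpoint nleaves (t : tree) : nat :=
  if t is Node s then sumn (map nleaves s) else 1.

(* Every vertex has at least three adjacent edges: at least two children,
   besides the edge towards the root. *)
Fixpoint reduced (t : tree) : bool :=
  if t is Node s then (1 < size s) && all reduced s else true.

Definition planar_tree (m : nat) : Type :=
  {t : tree | reduced t && (nleaves t == m)}.

HB.instance Definition _ m := Choice.on (planar_tree m).
HB.instance Definition _ m := [isSub for (@sval _ _ : planar_tree m -> tree)].

(* A vertex is encoded by its address: the sequence of positions of the
   children to follow from the root vertex [::]. *)
Fixpoint vertices (t : tree) : seq (seq nat) :=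
  if t is Node s then
    let vs := map vertices s in
    [::] :: flatten [seq map (cons i) (nth [::] vs i) | i <- iota 0 (size s)]
  else [::].

Definition Vert (t : tree) : finType := seq_sub (vertices t).

Definition address (t : tree) (v : Vert t) : seq nat := ssval v.

Definition parent (t : tree) (p v : Vert t) : bool :=
  prefix (address p) (address v) && (size (address v) == (size (address p)).+1).

(* [up_edge v w] and [down_edge v w]: some edge is oriented from v to w. *)
Definition up_edge (t : tree) : rel (Vert t) := fun v w => parent w v.
Definition down_edge (t : tree) : rel (Vert t) := fun v w => parent v w.

Definition up_prec (t : tree) : rel (Vert t) :=
  fun v1 v2 => (v1 != v2) && connect (@up_edge t) v2 v1.
Definition down_prec (t : tree) : rel (Vert t) :=
  fun v1 v2 => (v1 != v2) && connect (@down_edge t) v2 v1.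

(* Internal edges correspond to the vertices other than the root vertex: the
   address e stands for the edge joining the vertex e to its parent.
   [contract t e] is t with that edge contracted, the children of e being
   inserted, in order, in the place of e among the children of its parent. *)
Definition internal_edge (t : tree) (e : seq nat) : bool :=
  (e \in vertices t) && (e != [::]).

Fixpoint contract (t : tree) (e : seq nat) : tree :=
  let s := children t in
  match e with
  | [::] => t
  | i :: e' =>
    let u := nth Leaf s i in
    if e' is [::] then Node (take i s ++ children u ++ drop i.+1 s)
    else Node (set_nth Leaf s i (contract u e'))
  end.

(* The map induced on (the addresses of) the vertices by this contraction. *)
Fixpoint contract_vertex (t : tree) (e x : seq nat) : seq nat :=
  let s := children t in
  match e, x with
  | [::], _ => x
  | _, [::] => [::]
  | i :: e', j :: x' =>
    let u := nth Leaf s i in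
    if e' is [::] then
      if j < i then x
      else if j == i then (if x' is k :: y then i + k :: y else [::])
      else (j + size (children u)).-1 :: x'
    else if j == i then i :: contract_vertex u e' x' else x
  end.

Inductive contractions : tree -> tree -> (seq nat -> seq nat) -> Prop :=
| contractions_nil t : contractions t t id
| contractions_cons t e t' f :
    internal_edge t e -> contractions (contract t e) t' f ->
    contractions t t' (f \o contract_vertex t e).

Definition planar_map (t t' : tree) (phi : Vert t -> Vert t') : Prop :=
  exists2 f, contractions t t' f & forall v, address (phi v) = f (address v).

(* The levels {1, ..., h} are encoded by 'I_h = {0, ..., h - 1}. *)
Definition levels (V : finType) (prec : rel V) h (l : {ffun V -> 'I_h}) : bool :=
  [forall i, exists v, l v == i] &&
  [forall v1, forall v2, prec v1 v2 ==> (l v1 < l v2)].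

Definition order_preserving h h' (f : 'I_h -> 'I_h') : Prop :=
  {homo f : i j / i <= j}.

Record lT (m : nat) := LT {
  lT_U : planar_tree m;
  lT_h : nat;
  lT_l : {ffun Vert (val lT_U) -> 'I_lT_h};
  lT_levels : levels (@up_prec (val lT_U)) lT_l
}.

Definition lT_morphism m (X Y : lT m)
    (phi : Vert (val (lT_U X)) -> Vert (val (lT_U Y)))
    (hat : 'I_(lT_h X) -> 'I_(lT_h Y)) : Prop :=
  [/\ planar_map phi, order_preserving hat
    & forall v, lT_l Y (phi v) = hat (lT_l X v)].

Definition lT_le m (X Y : lT m) : Prop :=
  exists phi hat, @lT_morphism m X Y phi hat.

Definition pair_prec (U D : tree) : rel (Vert U + Vert D) := fun v1 v2 =>
  match v1, v2 with
  | inl u1, inl u2 => up_prec u1 u2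
  | inr d1, inr d2 => down_prec d1 d2
  | _, _ => false
  end.

Record clT (m n : nat) := CLT {
  clT_U : planar_tree m;
  clT_D : planar_tree n;
  clT_h : nat;
  clT_l : {ffun (Vert (val clT_U) + Vert (val clT_D))%type -> 'I_clT_h};
  clT_levels : levels (@pair_prec (val clT_U) (val clT_D)) clT_l
}.

Definition sum_map (A A' B B' : Type) (f : A -> A') (g : B -> B') (x : A + B) :
    A' + B' :=
  match x with inl a => inl (f a) | inr b => inr (g b) end.

Definition clT_morphism m n (X Y : clT m n)
    (phiu : Vert (val (clT_U X)) -> Vert (val (clT_U Y)))
    (phid : Vert (val (clT_D X)) -> Vert (val (clT_D Y)))
    (hat : 'I_(clT_h X) -> 'I_(clT_h Y)) : Prop :=
  [/\ planar_map phiu, planar_map phid, order_preserving hat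
    & forall v, clT_l Y (sum_map phiu phid v) = hat (clT_l X v)].

Definition clT_le m n (X Y : clT m n) : Prop :=
  exists phiu phid hat, @clT_morphism m n X Y phiu phid hat.

Lemma mem_vertices s i x :
  (i :: x \in vertices (Node s)) = (i < size s) && (x \in vertices (nth Leaf s i)).
Proof.
rewrite /= in_cons /=; apply/flatten_mapP/andP => [[j]|[lti xi]].
  rewrite mem_iota add0n => /andP[_ ltj] /mapP[y yj [-> ->]].
  by rewrite ltj; split=> //; rewrite (nth_map Leaf) in yj.
exists i; first by rewrite mem_iota.
by apply/mapP; exists x => //; rewrite (nth_map Leaf).
Qed.

Lemma contract_vertexP t e x : internal_edge t e -> x \in vertices t ->
  contract_vertex t e x \in vertices (contract t e).
Proof.
rewrite /internal_edge; elim: e t x => [|i e IH] t x; first by rewrite andbF.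
case: t => [//|s]; rewrite mem_vertices andbT => /andP[lti ei].
case: x => [|j x] xt; first by case: (e).
move: xt; rewrite mem_vertices => /andP[ltj xj].
case: e IH ei => [|k e] IH ei.
  rewrite [contract _ _]/= [contract_vertex _ _ _]/=.
  set c := children _; have def_u: nth Leaf s i = Node c.
    by rewrite /c; case: (nth Leaf s i) ei.
  have sz: size (take i s ++ c ++ drop i.+1 s) = (size s + size c).-1.
    by rewrite !size_cat size_take size_drop lti; lia.
  have szt: size (take i s) = i by rewrite size_take lti.
  case: (ltngtP j i) => [ltji|ltij|eqji].
  - rewrite mem_vertices sz nth_cat szt ltji nth_take // xj andbT; lia.
  - rewrite mem_vertices sz nth_cat szt ifN ?nth_cat ?ifN ?nth_drop; try lia.
    have -> : i.+1 + ((j + size c).-1 - i - size c) = j by lia.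
    by rewrite xj andbT; lia.
  - case: x xj => [//|k y]; rewrite eqji def_u mem_vertices => /andP[ltk yk].
    by rewrite mem_vertices sz nth_cat szt ifN ?addKn ?nth_cat ?ltk ?yk ?andbT; lia.
have -> : contract (Node s) (i :: k :: e) =
  Node (set_nth Leaf s i (contract (nth Leaf s i) (k :: e))) by [].
have -> : contract_vertex (Node s) (i :: k :: e) (j :: x) =
  if j == i then i :: contract_vertex (nth Leaf s i) (k :: e) x else j :: x by [].
case: eqP => [eqji|/eqP neji]; rewrite mem_vertices size_set_nth nth_set_nth /=.
  by rewrite eqxx leq_max ltnSn /= IH ?ei // -eqji.
by rewrite (negPf neji) leq_max ltj orbT.
Qed.

Lemma planar_map_id t : @planar_map t t id.
Proof. by exists id => //; exact: contractions_nil. Qed.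

Lemma planar_map_comp t1 t2 t3 (f : Vert t1 -> Vert t2) (g : Vert t2 -> Vert t3) :
  planar_map f -> planar_map g -> planar_map (g \o f).
Proof.
case=> f' cf ef [g' cg eg]; exists (g' \o f'); last by move=> v /=; rewrite eg ef.
elim: cf g' cg {f g ef eg} => [//|t e t' h ie _ IH] g' /IH cg.
exact: contractions_cons ie cg.
Qed.

Fixpoint nnodes (t : tree) : nat :=
  if t is Node s then (sumn (map nnodes s)).+1 else 0.

Lemma nnodes_contract t e : internal_edge t e -> (nnodes (contract t e)).+1 = nnodes t.
Proof.
rewrite /internal_edge; elim: e t => [|i e IH] t; first by rewrite andbF.
case: t => [//|s]; rewrite mem_vertices andbT => /andP[lti ei].
have def_s : s = take i s ++ nth Leaf s i :: drop i.+1 s.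
  by rewrite -drop_nth // cat_take_drop.
have -> : nnodes (Node s) =
    (sumn (map nnodes (take i s)) + nnodes (nth Leaf s i) +
     sumn (map nnodes (drop i.+1 s))).+1.
  by rewrite {1}def_s /= map_cat sumn_cat /=; lia.
case: e IH ei => [|k e] IH ei.
  have -> : contract (Node s) [:: i] =
    Node (take i s ++ children (nth Leaf s i) ++ drop i.+1 s) by [].
  case: (nth Leaf s i) ei => [//|c] _ /=; rewrite !map_cat !sumn_cat; lia.
have -> : contract (Node s) (i :: k :: e) =
  Node (set_nth Leaf s i (contract (nth Leaf s i) (k :: e))) by [].
rewrite -(IH (nth Leaf s i)) ?ei // set_nthE lti /= map_cat sumn_cat /=; lia.
Qed.

Lemma contractions_nnodes t t' f : contractions t t' f ->
  nnodes t' <= nnodes t ?= iff (t == t').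
Proof.
elim=> [{}t|{}t e {}t' {}f ie _ [le_t't _]]; first by split; rewrite ?eqxx.
have lt_t't : nnodes t' < nnodes t by rewrite -(nnodes_contract ie).
split; first exact: ltnW.
by rewrite ltn_eqF //; apply/esym/eqP => eqt; rewrite eqt ltnn in lt_t't.
Qed.

Lemma planar_map_anti t t' (f : Vert t -> Vert t') (g : Vert t' -> Vert t) :
  planar_map f -> planar_map g -> t = t'.
Proof.
move=> [f' /contractions_nnodes cf _] [g' /contractions_nnodes cg _].
by apply/eqP; rewrite -(geq_leqif cf) cg.
Qed.

Lemma contractions_endo t t' f : contractions t t' f -> t = t' -> f =1 id.
Proof.
case=> // {}t e {}t' h ie ch eqt.
have [+ _] := contractions_nnodes ch.
by rewrite -eqt -(nnodes_contract ie) ltnn.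
Qed.

Lemma planar_map_endo t (f : Vert t -> Vert t) : planar_map f -> f =1 id.
Proof.
by case=> f' cf ef v; apply: val_inj; rewrite [LHS]ef (contractions_endo cf).
Qed.

Lemma levels_anti (V : finType) (prec : rel V) h h'
    (l : {ffun V -> 'I_h}) (l' : {ffun V -> 'I_h'})
    (f : 'I_h -> 'I_h') (g : 'I_h' -> 'I_h) :
  levels prec l -> levels prec l' -> order_preserving f -> order_preserving g ->
  (forall v, l' v = f (l v)) -> (forall v, l v = g (l' v)) ->
  existT (fun k => {ffun V -> 'I_k}) h l = existT _ h' l'.
Proof.
move=> /andP[/forallP sl _] /andP[/forallP sl' _] mf mg lf lg.
have fK : cancel f g.
  by move=> i; have /existsP[v /eqP <-] := sl i; rewrite -lf -lg.
have gK : cancel g f.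
  by move=> i; have /existsP[v /eqP <-] := sl' i; rewrite -lg -lf.
have eqh : h = h'.
  by rewrite -[h]card_ord -[h']card_ord; apply: bij_eq_card (Bijective fK gK).
case: h' / eqh l' f g {sl'} mf mg lf lg fK gK => l' f g mf mg lf lg fK gK.
have le_id (p q : 'I_h -> 'I_h) : order_preserving p -> cancel p q ->
    forall i : 'I_h, i <= p i.
  move=> mp pK [i lti]; elim: i lti => [//|i IH] lti.
  have lti' := ltnW lti; apply: leq_ltn_trans (IH lti') _.
  rewrite ltn_neqAle mp //= ?andbT //; apply/eqP => /val_inj/(can_inj pK) [].
  by move/eqP; rewrite ltn_eqF.
congr existT; apply/ffunP=> v; apply/val_inj/eqP; rewrite eqn_leq lf.
by rewrite (le_id f g) //= -{2}[l v]fK (le_id g f).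
Qed.

Lemma lT_le_refl m (X : lT m) : lT_le X X.
Proof. by exists id, id; split=> //; exact: planar_map_id. Qed.

Lemma lT_le_trans m (Y X Z : lT m) : lT_le X Y -> lT_le Y Z -> lT_le X Z.
Proof.
move=> [p [f [pp mf lf]]] [q [g [pq mg lg]]]; exists (q \o p), (g \o f).
split=> [||v]; first exact: planar_map_comp.
  by move=> i j /mf/mg.
by rewrite /= lg lf.
Qed.

Lemma lT_le_anti m (X Y : lT m) : lT_le X Y -> lT_le Y X -> X = Y.
Proof.
case: X Y => [U h l L] [U' h' l' L'].
case=> p [f [/= pp mf lf]] [q [g [/= pq mg lg]]].
have eqU : U = U' by apply/val_inj/(planar_map_anti pp pq).
case: U' / eqU l' L' p f q g pp mf lf pq mg lg => l' L' p f q g pp mf lf pq mg lg.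
have lf' v : l' v = f (l v) by rewrite -lf (planar_map_endo pp).
have lg' v : l v = g (l' v) by rewrite -lg (planar_map_endo pq).
have := levels_anti L L' mf mg lf' lg'.
pose S := {k : nat & {ffun Vert (val U) -> 'I_k}}.
suff eqS (x y : S) (Lx : levels (@up_prec _) (tagged x))
    (Ly : levels (@up_prec _) (tagged y)) : x = y -> LT Lx = LT Ly.
  exact: (eqS (existT _ h l) (existT _ h' l')).
by move=> eqxy; case: y / eqxy Ly => Ly; congr LT; exact: bool_irrelevance.
Qed.

Lemma clT_le_refl m n (X : clT m n) : clT_le X X.
Proof.
exists id, id, id; split=> //; try exact: planar_map_id.
by case.
Qed.

Lemma clT_le_trans m n (Y X Z : clT m n) : clT_le X Y -> clT_le Y Z -> clT_le X Z.
Proof.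
move=> [p [r [f [pp pr mf lf]]]] [q [s [g [pq ps mg lg]]]].
exists (q \o p), (s \o r), (g \o f).
split=> [|||v]; try exact: planar_map_comp.
  by move=> i j /mf/mg.
by rewrite /= -lf -lg; case: v.
Qed.

Lemma clT_le_anti m n (X Y : clT m n) : clT_le X Y -> clT_le Y X -> X = Y.
Proof.
case: X Y => [U D h l L] [U' D' h' l' L'].
case=> p [r [f [/= pp pr mf lf]]] [q [s [g [/= pq ps mg lg]]]].
have eqU : U = U' by apply/val_inj/(planar_map_anti pp pq).
have eqD : D = D' by apply/val_inj/(planar_map_anti pr ps).
case: U' / eqU l' L' p r f q s g pp pr mf lf pq ps mg lg =>
  l' L' p r f q s g pp pr mf lf pq ps mg lg.
case: D' / eqD l' L' p r f q s g pp pr mf lf pq ps mg lg =>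
  l' L' p r f q s g pp pr mf lf pq ps mg lg.
have lf' v : l' v = f (l v).
  by rewrite -lf; case: v => v /=; rewrite ?(planar_map_endo pp) ?(planar_map_endo pr).
have lg' v : l v = g (l' v).
  by rewrite -lg; case: v => v /=; rewrite ?(planar_map_endo pq) ?(planar_map_endo ps).
have := levels_anti L L' mf mg lf' lg'.
pose S := {k : nat & {ffun (Vert (val U) + Vert (val D))%type -> 'I_k}}.
suff eqS (x y : S) (Lx : levels (@pair_prec _ _) (tagged x))
    (Ly : levels (@pair_prec _ _) (tagged y)) : x = y -> CLT Lx = CLT Ly.
  exact: (eqS (existT _ h l) (existT _ h' l')).
by move=> eqxy; case: y / eqxy Ly => Ly; congr CLT; exact: bool_irrelevance.
Qed.

HB.instance Definition _ m := gen_eqMixin (lT m).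
HB.instance Definition _ m := gen_choiceMixin (lT m).
HB.instance Definition _ m n := gen_eqMixin (clT m n).
HB.instance Definition _ m n := gen_choiceMixin (clT m n).

Fact lT_display : Order.disp_t. Proof. exact: Order.Disp tt tt. Qed.
Fact clT_display : Order.disp_t. Proof. exact: Order.Disp tt tt. Qed.

Definition lT_leb m : rel (lT m) := fun X Y => `[< lT_le X Y >].
Definition clT_leb m n : rel (clT m n) := fun X Y => `[< clT_le X Y >].

Fact lT_leb_refl m : reflexive (@lT_leb m).
Proof. by move=> X; apply/asboolP; exact: lT_le_refl. Qed.

Fact lT_leb_anti m : antisymmetric (@lT_leb m).
Proof. by move=> X Y /andP[/asboolP XY /asboolP YX]; exact: lT_le_anti. Qed.

Fact lT_leb_trans m : transitive (@lT_leb m).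
Proof.
by move=> Y X Z /asboolP XY /asboolP YZ; apply/asboolP; exact: lT_le_trans YZ.
Qed.

Fact clT_leb_refl m n : reflexive (@clT_leb m n).
Proof. by move=> X; apply/asboolP; exact: clT_le_refl. Qed.

Fact clT_leb_anti m n : antisymmetric (@clT_leb m n).
Proof. by move=> X Y /andP[/asboolP XY /asboolP YX]; exact: clT_le_anti. Qed.

Fact clT_leb_trans m n : transitive (@clT_leb m n).
Proof.
by move=> Y X Z /asboolP XY /asboolP YZ; apply/asboolP; exact: clT_le_trans YZ.
Qed.

HB.instance Definition _ m := Order.Le_isPOrder.Build lT_display (lT m)
  (@lT_leb_refl m) (@lT_leb_anti m) (@lT_leb_trans m).
HB.instance Definition _ m n := Order.Le_isPOrder.Build clT_display (clT m n)
  (@clT_leb_refl m n) (@clT_leb_anti m n) (@clT_leb_trans m n).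

Lemma lT_leP m (X Y : lT m) : reflect (lT_le X Y) (X <= Y)%O.
Proof. exact: asboolP. Qed.

Lemma clT_leP m n (X Y : clT m n) : reflect (clT_le X Y) (X <= Y)%O.
Proof. exact: asboolP. Qed.

Definition poset_isomorphism d d' (P : porderType d) (Q : porderType d')
    (f : P -> Q) : Prop :=
  bijective f /\ {mono f : x y / (x <= y)%O}.

(* Main.v *)
Require Import Defs.
From mathcomp Require Import all_boot all_order.
From mathcomp Require Import zify boolp.

(** Both posets are the poset of surjections from the m + n - 2 gaps between
    consecutive leaves onto an initial segment of levels, ordered by
    coarsening.

    In a planar tree, each gap between two consecutive leaves belongs to one
    vertex, the last one common to the paths from the root to the two leaves,
    and in a reduced tree each vertex owns at least one gap.  Reading the levels
    of these vertices from left to right turns a levelled tree with m leaves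
    into a word of length m - 1 ([tree_word]), and the planar maps enter this
    picture because a contraction carries the vertex of each gap to the vertex
    of the same gap ([gaps_contract]).

    Along the paths leaving the root, levels increase strictly in an up-rooted
    tree and decrease strictly in a down-rooted one.  So, up to reversing the
    order of levels, the root owns exactly the gaps with the minimal level;
    these cut the word into the words of the subtrees, and hence the word
    determines the tree ([strictly_levelled_inj]).  Every word occurs: cutting
    it at one occurrence of the minimum, recursively, gives a binary tree whose
    levels are weakly monotone, and contracting all the edges between equal
    levels makes them strictly monotone without changing the word
    ([strictly_levelled_exists]).

    The same contraction argument handles morphisms.  If replacing the word of
    t by the word of t' preserves the order of levels, the new levels are weakly
    monotone on t; contracting the edges between equal levels gives a strictly
    levelled tree with the word of t', which must be t'
    ([strictly_levelled_contractions]).  Therefore X <= Y holds exactly when the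
    word of Y coarsens that of X.

    A complementary pair is encoded by the word of U followed by the word of D.
    Reversing the order of the levels for D does not affect coarsening, so the
    two trees impose no condition on each other, and complementary pairs too
    correspond to all the words of length m + n - 2 in which the levels form an
    initial segment. *)

Set Implicit Arguments.
Unset Strict Implicit.
Unset Printing Implicit Defensive.

(** * The vertices that own the gaps between leaves *)

Lemma tree_forest_ind (P : tree -> Prop) :
  P Leaf -> (forall s, {in s, forall u, P u} -> P (Node s)) -> forall t, P t.
Proof.
move=> P0 PS; fix IH 1; case=> [//|s]; apply: PS.
elim: s => [v|u s IHs v]; first by rewrite in_nil => vn; case: (notF vn).
rewrite in_cons; case: eqP => [-> _|_ /IHs]; [exact: IH|exact].
Qed.

(** The list is indexed by the gaps between consecutive leaves, from left to
    right.  Each child contributes its own gaps, and two neighbouring children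
    are separated by a gap of the root [::]: [blocks] puts such a gap in front
    of every child, and the one before the first child is dropped. *)
Fixpoint gaps (t : tree) : seq (seq nat) :=
  if t is Node s then
    behead ((fix blocks k s := if s is u :: s' then
               ([::] :: map (cons k) (gaps u)) ++ blocks k.+1 s' else [::]) 0 s)
  else [::].

Fixpoint blocks k (s : seq tree) : seq (seq nat) :=
  if s is u :: s' then ([::] :: map (cons k) (gaps u)) ++ blocks k.+1 s' else [::].

Lemma gaps_Node s : gaps (Node s) = behead (blocks 0 s).
Proof. by []. Qed.

Lemma blocks_cat k s1 s2 : blocks k (s1 ++ s2) = blocks k s1 ++ blocks (k + size s1) s2.
Proof.
elim: s1 k => [|u s IH] k /=; first by rewrite addn0.
by rewrite IH addnS -catA.
Qed.

Lemma blocks_cons k u s :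
  blocks k (u :: s) = ([::] :: map (cons k) (gaps u)) ++ blocks k.+1 s.
Proof. by []. Qed.

Lemma blocks_behead k s : 0 < size s -> blocks k s = [::] :: behead (blocks k s).
Proof. by case: s. Qed.

Lemma mem_blocks k s i x : (i :: x \in blocks k s) =
  (k <= i < k + size s) && (x \in gaps (nth Leaf s (i - k))).
Proof.
elim: s k => [|u s IH] k /=; first by rewrite addn0; case: ltngtP.
rewrite in_cons mem_cat IH /=.
have -> : (i :: x \in map (cons k) (gaps u)) = (i == k) && (x \in gaps u).
  apply/mapP/andP => [[y yu [-> ->]] //|[/eqP -> xu]]; by exists x.
case: (ltngtP i k) => [ltik|ltki|->] /=.
- by [].
- have -> : i - k = (i - k.+1).+1 by lia.
  by rewrite /= addSnnS.
- by rewrite subnn /= orbF addnS ltnS leq_addr.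
Qed.

Lemma mem_gaps s i x :
  (i :: x \in gaps (Node s)) = (i < size s) && (x \in gaps (nth Leaf s i)).
Proof.
rewrite gaps_Node; have := mem_blocks 0 s i x; rewrite subn0 add0n /= => <-.
by case: s.
Qed.

Lemma gaps_sub t x : x \in gaps t -> x \in vertices t.
Proof.
elim/tree_forest_ind: t x => [//|s IH] [|i x]; first by rewrite in_cons.
rewrite mem_gaps mem_vertices => /andP[lti /IH ->]; first by rewrite lti.
exact: mem_nth.
Qed.

Lemma reduced_Node s : reduced (Node s) = (1 < size s) && all reduced s.
Proof. by []. Qed.

(** A vertex owns one gap fewer than it has children, hence at least one in a
    reduced tree. *)
Lemma mem_gaps_reduced t : reduced t -> gaps t =i vertices t.
Proof.
move=> rt x; apply/idP/idP; first exact: gaps_sub.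
elim/tree_forest_ind: t rt x => [//|s IH]; rewrite reduced_Node.
move=> /andP[sz /allP rs] [|i x] xt.
  by rewrite gaps_Node; case: s sz {IH rs xt} => [|u [|v s]] //= _;
    rewrite mem_cat in_cons eqxx orbT.
move: xt; rewrite mem_gaps mem_vertices => /andP[lti xi]; rewrite lti.
by apply: IH xi; [exact: mem_nth|apply: rs; exact: mem_nth].
Qed.

Lemma size_gaps t : reduced t -> (size (gaps t)).+1 = nleaves t.
Proof.
elim/tree_forest_ind: t => [//|s IH]; rewrite reduced_Node => /andP[sz /allP rs].
have E k : size (blocks k s) = sumn (map nleaves s).
  elim: s k IH rs {sz} => [//|u s IHs] k IH rs /=.
  rewrite size_cat size_map IHs => [|v vs|v vs].
  - by rewrite -addSn IH ?rs ?mem_head.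
  - by apply: IH; rewrite in_cons vs orbT.
  - by apply: rs; rewrite in_cons vs orbT.
rewrite gaps_Node size_behead E /= prednK // -(E 0).
by case: s sz {IH rs E}.
Qed.

(** * The effect of a contraction on the gaps *)

Lemma nth_mid s1 u s2 : nth Leaf (s1 ++ u :: s2) (size s1) = u.
Proof. by rewrite nth_cat ltnn subnn. Qed.

(** This displays the siblings on either side of the path to the contracted
    edge, so that every case below becomes an identity between
    concatenations. *)
Lemma internal_edge_ind (P : tree -> seq nat -> Prop) :
  (forall s1 c s2, P (Node (s1 ++ Node c :: s2)) [:: size s1]) ->
  (forall s1 u s2 e, e != [::] -> internal_edge u e -> P u e ->
     P (Node (s1 ++ u :: s2)) (size s1 :: e)) ->
  forall t e, internal_edge t e -> P t e.
Proof.
move=> P0 PS t e; rewrite /internal_edge.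
elim: e t => [|i e IH] t; first by rewrite andbF.
case: t => [//|s]; rewrite mem_vertices andbT => /andP[lti ei].
have def_s : s = take i s ++ nth Leaf s i :: drop i.+1 s.
  by rewrite -drop_nth // cat_take_drop.
have szi : i :: e = size (take i s) :: e by rewrite size_take lti.
rewrite {}szi [in Node s]def_s; move: (take i s) (drop i.+1 s) => s1 s2.
case: e IH ei => [|k e] IH ei; first by case: (nth Leaf s i) ei => // c _; apply: P0.
by apply: PS; rewrite /internal_edge ?ei //; apply: IH; rewrite ei.
Qed.

Lemma contract_child s1 u s2 :
  contract (Node (s1 ++ u :: s2)) [:: size s1] = Node (s1 ++ children u ++ s2).
Proof. by rewrite /= nth_mid take_size_cat // drop_cat ltnNge leqnSn subSnn /= drop0. Qed.

Lemma contract_below s1 u s2 e : e != [::] ->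
  contract (Node (s1 ++ u :: s2)) (size s1 :: e) = Node (s1 ++ contract u e :: s2).
Proof.
case: e => [//|k e] _; set e' := k :: e.
rewrite [LHS]/= -/e' nth_mid set_nthE size_cat /= addnS ltnS leq_addr take_size_cat //.
by rewrite drop_cat ltnNge leqnSn subSnn /= drop0.
Qed.

Lemma contract_vertex_child s1 u s2 j x :
  contract_vertex (Node (s1 ++ u :: s2)) [:: size s1] (j :: x) =
  if j < size s1 then j :: x
  else if j == size s1 then (if x is k :: y then size s1 + k :: y else [::])
  else (j + size (children u)).-1 :: x.
Proof. by rewrite /= nth_mid. Qed.

Lemma contract_vertex_below s1 u s2 e j x : e != [::] ->
  contract_vertex (Node (s1 ++ u :: s2)) (size s1 :: e) (j :: x) =
  if j == size s1 then size s1 :: contract_vertex u e x else j :: x.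
Proof. by case: e => // k e _; rewrite [LHS]/= nth_mid. Qed.

Lemma contract_vertex_nil t e : contract_vertex t e [::] = [::].
Proof. by case: e. Qed.

Lemma reduced_contract t e : internal_edge t e -> reduced t -> reduced (contract t e).
Proof.
move=> ie; elim/internal_edge_ind: ie => {t e} [s1 c s2|s1 u s2 e en _ IH].
  rewrite contract_child !reduced_Node !all_cat /= !size_cat /=.
  by move=> /andP[_ /and3P[-> /andP[sc ->] ->]]; rewrite !andbT /=; lia.
rewrite contract_below // !reduced_Node !all_cat /= !size_cat /=.
by move=> /andP[-> /and3P[-> /IH -> ->]].
Qed.

Lemma map_blocks (f : seq nat -> seq nat) k k' s : f [::] = [::] ->
  (forall j x, j < size s -> f (k + j :: x) = k' + j :: x) ->
  map f (blocks k s) = blocks k' s.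
Proof.
move=> f0; elim: s k k' => [//|u s IH] k k' fE.
rewrite /= f0 map_cat (IH _ k'.+1) => [|j x ltj]; last by rewrite !addSnnS fE.
congr (_ :: (_ ++ _)); rewrite -map_comp; apply: eq_map => x /=.
by have := fE 0 x isT; rewrite !addn0.
Qed.

(** Contracting an edge leaves the leaves in place; the merged vertex owns the
    gaps of both ends of the edge. *)
Lemma gaps_contract t e : internal_edge t e -> reduced t ->
  map (contract_vertex t e) (gaps t) = gaps (contract t e).
Proof.
move=> ie; elim/internal_edge_ind: ie => {t e} [s1 c s2|s1 u s2 e en _ IH].
  rewrite reduced_Node all_cat => /andP[_ /andP[_ /andP[/andP[sc _] _]]].
  rewrite contract_child [children _]/= !gaps_Node.
  rewrite -behead_map !blocks_cat; congr behead.
  rewrite map_cat add0n; congr (_ ++ _).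
    by apply: map_blocks => // j x ltj; rewrite contract_vertex_child ltj.
  rewrite blocks_cons map_cat gaps_Node.
  congr (_ ++ _).
    pose f (x : seq nat) := if x is k :: y then size s1 + k :: y else [::].
    rewrite -(@map_blocks f 0 (size s1)) // (blocks_behead 0) ?(ltnW sc) // !map_cons -map_comp.
    congr cons; apply: eq_map => x.
    by rewrite [LHS]contract_vertex_child ltnn eqxx.
  apply: map_blocks => // j x ltj.
  rewrite contract_vertex_child addSn ltnNge -addnS leq_addr /=.
  by rewrite ifN; [congr cons; rewrite /=; lia|lia].
rewrite reduced_Node all_cat => /andP[_ /andP[_ /andP[ru _]]].
rewrite contract_below // !gaps_Node -behead_map !blocks_cat; congr behead.
rewrite !blocks_cons add0n !map_cat.
congr (_ ++ (_ ++ _)).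
- by apply: map_blocks => // j x ltj; rewrite contract_vertex_below // ltn_eqF.
- rewrite map_cons contract_vertex_nil -IH // -!map_comp; congr cons; apply: eq_map => x.
  by rewrite [LHS]contract_vertex_below // eqxx.
- apply: map_blocks => // j x ltj.
  by rewrite contract_vertex_below // gtn_eqF // addSn ltnS leq_addr.
Qed.

Lemma contractions_reduced t t' f : contractions t t' f -> reduced t -> reduced t'.
Proof. by elim=> // {}t e {}t' {}f ie _ IH rt; apply/IH/reduced_contract. Qed.

Lemma contractions_gaps t t' f : contractions t t' f -> reduced t ->
  map f (gaps t) = gaps t'.
Proof.
elim=> [{}t _|{}t e {}t' {}f ie _ IH rt]; first exact: map_id.
by rewrite map_comp gaps_contract // IH // reduced_contract.
Qed.

Lemma contractions_vertices t t' f x : contractions t t' f ->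
  x \in vertices t -> f x \in vertices t'.
Proof. by move=> ct; elim: ct x => // {}t e {}t' {}f ie _ IH x /(contract_vertexP ie)/IH. Qed.

(** * Sections of contractions *)

(** A section of [contract_vertex t e] that sends the merged vertex to the end
    of the contracted edge nearer the root.  Levels are transported to the
    contracted tree by composing with it. *)
Fixpoint uncontract_vertex (t : tree) (e y : seq nat) : seq nat :=
  let s := children t in
  match e, y with
  | [::], _ => y
  | _, [::] => [::]
  | i :: e', j :: y' =>
    let u := nth Leaf s i in
    if e' is [::] then
      if j < i then y
      else if j < i + size (children u) then i :: j - i :: y'
      else j.+1 - size (children u) :: y'
    else if j == i then i :: uncontract_vertex u e' y' else y
  end.

Lemma uncontract_vertex_child s1 u s2 j y :
  uncontract_vertex (Node (s1 ++ u :: s2)) [:: size s1] (j :: y) =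
  if j < size s1 then j :: y
  else if j < size s1 + size (children u) then size s1 :: j - size s1 :: y
  else j.+1 - size (children u) :: y.
Proof. by rewrite /= nth_mid. Qed.

Lemma uncontract_vertex_below s1 u s2 e j y : e != [::] ->
  uncontract_vertex (Node (s1 ++ u :: s2)) (size s1 :: e) (j :: y) =
  if j == size s1 then size s1 :: uncontract_vertex u e y else j :: y.
Proof. by case: e => // k e _; rewrite [LHS]/= nth_mid. Qed.

Lemma uncontract_vertex_nil t e : uncontract_vertex t e [::] = [::].
Proof. by case: e. Qed.

Lemma uncontract_vertexP t e y : internal_edge t e ->
  y \in vertices (contract t e) -> uncontract_vertex t e y \in vertices t.
Proof.
move=> ie; elim/internal_edge_ind: ie y => {t e} [s1 c s2|s1 u s2 e en _ IH] [|j y].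
- by rewrite uncontract_vertex_nil.
- rewrite contract_child uncontract_vertex_child [children _]/= mem_vertices.
  rewrite !size_cat nth_cat => /andP[].
  case: (ltnP j (size s1)) => ltj.
    by rewrite mem_vertices nth_cat ltj size_cat => _ ->; rewrite andbT; lia.
  rewrite nth_cat; case: (ltnP j (size s1 + size c)) => ltjc lt.
    rewrite ifT ?mem_vertices; last by lia.
    by rewrite nth_mid mem_vertices size_cat /= => ->; rewrite andbT; lia.
  rewrite ifF; last by lia.
  rewrite mem_vertices nth_cat size_cat ifF; last by lia.
  have -> : j.+1 - size c - size s1 = (j - size s1 - size c).+1 by lia.
  by move=> /= ->; rewrite andbT; lia.
- by rewrite uncontract_vertex_nil.
rewrite contract_below // uncontract_vertex_below //.
rewrite mem_vertices size_cat /= nth_cat => /andP[ltj].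
case: (eqVneq j) => [->|nej].
  by rewrite ltnn subnn mem_vertices nth_mid size_cat /= => /IH ->; rewrite andbT; lia.
rewrite mem_vertices size_cat nth_cat /= ltj.
case: (ltnP j) => // lej; have -> // : j - size s1 = (j - size s1).-1.+1 by lia.
Qed.

Lemma prefix_uncontract_vertex t e x y : prefix x y ->
  prefix (uncontract_vertex t e x) (uncontract_vertex t e y).
Proof.
elim: e t x y => [//|i e IH] t [|j x] y.
  by rewrite uncontract_vertex_nil; case: uncontract_vertex.
case: y => [//|k y].
rewrite prefix_cons => /andP[/eqP <- pxy] /=.
case: e IH => [|l e] IH; first by case: ifP => _; [|case: ifP => _]; rewrite !prefix_cons !eqxx.
by case: ifP => _; rewrite prefix_cons eqxx //= IH.
Qed.

Definition parent_address (e : seq nat) := take (size e).-1 e.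

Lemma contract_vertexK t e x : internal_edge t e -> x \in vertices t ->
  uncontract_vertex t e (contract_vertex t e x) =
  if x == e then parent_address e else x.
Proof.
move=> ie; elim/internal_edge_ind: ie x => {t e} [s1 c s2|s1 u s2 e en _ IH] [|j x].
- by [].
- rewrite mem_vertices contract_vertex_child nth_cat size_cat [children _]/= => /andP[_ xv].
  rewrite eqseq_cons.
  case: (ltngtP j (size s1)) xv => [ltj|gtj|->] xv.
  + by rewrite uncontract_vertex_child ltj.
  + rewrite uncontract_vertex_child [children _]/= ifF; last by lia.
    by rewrite ifF; [congr cons|]; lia.
  + case: x xv => [//|k x]; rewrite subnn mem_vertices => /andP[ltk _].
    rewrite uncontract_vertex_child [children _]/= ifF; last by lia.
    by rewrite ltn_add2l ltk addKn.
- by rewrite contract_vertex_nil uncontract_vertex_nil.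
rewrite mem_vertices contract_vertex_below // => /andP[_]; rewrite eqseq_cons.
case: (eqVneq j) => [->|nej] xv; last by rewrite uncontract_vertex_below // (negPf nej).
rewrite uncontract_vertex_below // eqxx IH ?nth_mid //=; last by rewrite nth_mid in xv.
by case: eqP => // _; rewrite /parent_address; case: e en {IH}.
Qed.

(** * Contracting weak levels to strict levels *)

Lemma vertices_prefix t x y : x ++ y \in vertices t -> x \in vertices t.
Proof.
elim: x t y => [|i x IH] t y; first by case: t.
by case: t => // s; rewrite cat_cons !mem_vertices => /andP[-> /IH].
Qed.

(** Up-rooted trees use [leq] and down-rooted ones [geq]: the arguments below
    apply to both. *)
Definition total_order (le : rel nat) :=
  [/\ reflexive le, antisymmetric le, transitive le & total le].

Lemma total_order_leq_geq le : le = leq \/ le = geq -> total_order le.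
Proof. by case=> ->; split=> x *; rewrite /geq /=; lia. Qed.

Definition weakly_levelled (le : rel nat) (t : tree) (L : seq nat -> nat) :=
  {in vertices t &, forall x y, prefix x y -> le (L x) (L y)}.

Definition strictly_levelled (le : rel nat) (t : tree) (L : seq nat -> nat) :=
  {in vertices t &, forall x y, prefix x y -> x != y -> le (L x) (L y) && (L x != L y)}.

(** If a vertex has the same level as one of its descendants, then by weak
    monotonicity the level is constant on the path between them, in particular
    along the last edge of this path. *)
Lemma strictly_levelled_or_edge le t L : total_order le -> weakly_levelled le t L ->
  strictly_levelled le t L \/
  exists2 e, internal_edge t e & L e = L (parent_address e).
Proof.
move=> [_ anti _ _] wL.
case: (pselect (exists2 e, internal_edge t e & L e = L (parent_address e)));
  first by right.
move=> noe; left=> x y xt yt pxy nxy; rewrite (wL x y) //=; apply/negP => /eqP eqL.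
apply: noe; exists y; first by rewrite /internal_edge yt; case: (y) pxy nxy; case: (x).
have [z def_y] := prefixP pxy; case/lastP: z => [|z i] in def_y.
  by rewrite def_y cats0 eqxx in nxy.
have def_p : parent_address y = x ++ z.
  by rewrite /parent_address def_y -rcons_cat size_rcons -cats1 take_size_cat.
have pt : x ++ z \in vertices t.
  by move: yt; rewrite def_y -rcons_cat -cats1; apply: vertices_prefix.
rewrite def_p; apply: anti; apply/andP; split.
  by rewrite -eqL wL ?prefix_prefix.
by rewrite wL // def_y -rcons_cat prefix_rcons.
Qed.

(** Contracting an edge between equal levels preserves the levels and their
    weak monotonicity, and removes a vertex. *)
Lemma contract_to_strict le t L : total_order le -> weakly_levelled le t L ->
  exists t' f L', [/\ contractions t t' f, strictly_levelled le t' L' &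
                      {in vertices t, forall x, L' (f x) = L x}].
Proof.
move=> ole; have [n] := ubnP (nnodes t); elim: n t L => // n IH t L ltn wL.
have [sL|[e ie eqL]] := strictly_levelled_or_edge ole wL.
  by exists t, id, L; split=> //; exact: contractions_nil.
pose M := L \o uncontract_vertex t e.
have wM : weakly_levelled le (contract t e) M.
  move=> x y xt yt pxy; apply: wL; rewrite ?uncontract_vertexP //.
  exact: prefix_uncontract_vertex.
have [|t' [f [L' [ct sL' eqL']]]] := IH _ _ _ wM.
  by rewrite -ltnS (nnodes_contract ie).
exists t', (f \o contract_vertex t e), L'; split=> // [|x xt].
  exact: contractions_cons ie ct.
rewrite /= eqL' ?contract_vertexP // /M /= contract_vertexK //.
by case: eqP => // ->.
Qed.

(** * A strictly levelled tree is determined by its word *)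

Lemma cat_at_marker (T : eqType) (a : T) (w1 w2 r1 r2 : seq T) :
  a \notin w1 -> a \notin w2 -> ohead r1 \in [:: None; Some a] ->
  ohead r2 \in [:: None; Some a] -> w1 ++ r1 = w2 ++ r2 -> w1 = w2 /\ r1 = r2.
Proof.
elim: w1 w2 => [|b w1 IH] [|c w2] //=.
- by move=> _ aw2 + _ def; rewrite def !inE => /eqP[ca]; rewrite ca mem_head in aw2.
- by move=> aw1 _ _ + def; rewrite -def !inE => /eqP[ca]; rewrite ca mem_head in aw1.
rewrite !in_cons !negb_or => /andP[_ aw1] /andP[_ aw2] h1 h2 [-> /IH].
by case=> // -> ->.
Qed.

Lemma strictly_levelled_child le s L i : strictly_levelled le (Node s) L ->
  i < size s -> strictly_levelled le (nth Leaf s i) (L \o cons i).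
Proof.
move=> sL lti x y xt yt pxy nxy.
apply: (sL (i :: x) (i :: y)); rewrite ?mem_vertices ?lti //.
  by rewrite prefix_cons eqxx.
by rewrite eqseq_cons eqxx.
Qed.

(** The level a of the root occurs in no subtree, so its occurrences mark where
    the words of the successive subtrees begin. *)
Lemma blocks_inj a (L L' : seq nat -> nat) k s s' : L [::] = a -> L' [::] = a ->
  (forall i, i < size s -> i < size s' ->
     [seq L (k + i :: x) | x <- gaps (nth Leaf s i)] =
     [seq L' (k + i :: x) | x <- gaps (nth Leaf s' i)] ->
     nth Leaf s i = nth Leaf s' i) ->
  (forall i, i < size s -> a \notin [seq L (k + i :: x) | x <- gaps (nth Leaf s i)]) ->
  (forall i, i < size s' -> a \notin [seq L' (k + i :: x) | x <- gaps (nth Leaf s' i)]) ->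
  map L (blocks k s) = map L' (blocks k s') -> s = s'.
Proof.
move=> La L'a; elim: s s' k => [|u s IH] [|u' s'] k // inj aL aL'.
have head_blocks M j v : M [::] = a ->
    ohead (map M (blocks j v)) \in [:: None; Some a].
  by case: v => //= ? ? ->; rewrite !inE eqxx.
rewrite !blocks_cons !map_cat !map_cons -!map_comp La L'a => -[].
have := aL 0 isT; have := aL' 0 isT; rewrite addn0 => au' au.
move=> eqw; have [|| equ eqs] := cat_at_marker au au' _ _ eqw; rewrite ?head_blocks //.
congr cons; first by apply: (inj 0); rewrite ?addn0.
apply: (IH s' k.+1) => // [i lti lti' eqi|i lti|i lti].
- by apply: (inj i.+1); rewrite -?addSnnS.
- by have := aL i.+1 lti; rewrite -addSnnS.
- by have := aL' i.+1 lti; rewrite -addSnnS.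
Qed.

(** The level of the root is the least letter of the word. *)
Lemma strictly_levelled_inj le t t' L L' : total_order le ->
  reduced t -> reduced t' -> strictly_levelled le t L -> strictly_levelled le t' L' ->
  map L (gaps t) = map L' (gaps t') -> t = t'.
Proof.
move=> [le_refl anti _ _].
have root_le s M x : strictly_levelled le (Node s) M -> x \in vertices (Node s) ->
    le (M [::]) (M x).
  move=> sM xv; have [<-|nx] := eqVneq [::] x; first exact: le_refl.
  by have /andP[] := sM [::] x (mem_head _ _) xv (prefix0s _) nx.
have root_gap s : reduced (Node s) -> [::] \in gaps (Node s).
  by move=> rs; rewrite mem_gaps_reduced // mem_head.
have root_notin s M i : strictly_levelled le (Node s) M -> i < size s ->
    M [::] \notin [seq M (i :: x) | x <- gaps (nth Leaf s i)].
  move=> sM lti; apply/mapP => -[x /gaps_sub xv eqM].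
  have ixv : i :: x \in vertices (Node s) by rewrite mem_vertices lti.
  by have := sM [::] (i :: x) (mem_head _ _) ixv isT isT; rewrite eqM eqxx andbF.
elim/tree_forest_ind: t t' L L' => [|s IH] [|s'] L L' // rs rs' sL sL' eqw.
- by have := root_gap _ rs'; move: eqw; case: (gaps (Node s')).
- by have := root_gap _ rs; move: eqw; case: (gaps (Node s)).
have eqa : L' [::] = L [::].
  have /mapP[x /gaps_sub xv eqx] : L [::] \in map L' (gaps (Node s')).
    by rewrite -eqw map_f // root_gap.
  have /mapP[y /gaps_sub yv eqy] : L' [::] \in map L (gaps (Node s)).
    by rewrite eqw map_f // root_gap.
  by apply: anti; rewrite {1}eqx (root_le s') // eqy (root_le s).
congr Node; apply: (@blocks_inj (L [::]) L L' 0) => // [i lti lti' eqi|||].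
- apply: (IH _ (mem_nth Leaf lti) _ (L \o cons i) (L' \o cons i)) => //.
  + by move: rs; rewrite reduced_Node => /andP[_ /allP]; apply; apply: mem_nth.
  + by move: rs'; rewrite reduced_Node => /andP[_ /allP]; apply; apply: mem_nth.
  + exact: strictly_levelled_child.
  + exact: strictly_levelled_child.
- by move=> i; apply: root_notin.
- by move=> i; rewrite -eqa; apply: root_notin.
have [sn sn'] : 0 < size s /\ 0 < size s'.
  by move: rs rs'; rewrite !reduced_Node => /andP[/ltnW-> _] /andP[/ltnW-> _].
by rewrite (blocks_behead 0 sn) (blocks_behead 0 sn') !map_cons eqa -!gaps_Node eqw.
Qed.

(** * Trees and contractions with prescribed words *)

(** Cut the word at an occurrence of its least letter, which becomes the root of
    a binary tree. *)
Lemma weakly_levelled_exists le (w : seq nat) : total_order le ->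
  exists t L, [/\ reduced t, weakly_levelled le t L & map L (gaps t) = w].
Proof.
move=> [le_refl _ le_trans le_total].
have [n] := ubnP (size w); elim: n w => // n IH w ltn.
have [->|wn] := eqVneq w [::]; first by exists Leaf, (fun=> 0).
have [a aw le_a] : exists2 a, a \in w & {in w, forall b, le a b}.
  have sz : 0 < size (sort le w) by rewrite size_sort; case: (w) wn.
  case def_s: (sort le w) sz => [//|a s] _.
  exists a => [|b]; rewrite -(mem_sort le) def_s ?mem_head //.
  have := sort_sorted le_total w.
  rewrite def_s in_cons => /(order_path_min le_trans)/allP le_a.
  by case/predU1P=> [->|/le_a].
case/splitPr: aw ltn le_a {wn} => w1 w2; rewrite size_cat /= addnS !ltnS => ltn le_a.
have lt1 : size w1 < n := leq_ltn_trans (leq_addr _ _) ltn.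
have lt2 : size w2 < n := leq_ltn_trans (leq_addl _ _) ltn.
have [t1 [L1 [r1 wL1 def_w1]]] := IH _ lt1.
have [t2 [L2 [r2 wL2 def_w2]]] := IH _ lt2.
pose L x := match x with [::] => a | 0 :: y => L1 y | _ :: y => L2 y end.
have def_gaps : map L (gaps (Node [:: t1; t2])) = w1 ++ a :: w2.
  by rewrite gaps_Node /= cats0 map_cat map_cons -!map_comp -def_w1 -def_w2.
exists (Node [:: t1; t2]), L; split=> //; first by rewrite /= r1 r2.
move=> [|i x] y xv yv pxy.
  by apply: le_a; rewrite -def_gaps map_f // mem_gaps_reduced //= r1 r2.
case: y pxy yv => // j y; rewrite prefix_cons => /andP[/eqP <- pxy].
move: xv; rewrite !mem_vertices.
case: i => [|[|//]] /= xv yv; [exact: wL1|exact: wL2].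
Qed.

Lemma strictly_levelled_exists le (w : seq nat) : total_order le ->
  exists t L, [/\ reduced t, strictly_levelled le t L & map L (gaps t) = w].
Proof.
move=> ole; have [t [L [rt wL def_w]]] := weakly_levelled_exists w ole.
have [t' [f [L' [ct sL' eqL']]]] := contract_to_strict ole wL.
exists t', L'; split=> //; first exact: contractions_reduced ct rt.
rewrite -(contractions_gaps ct rt) -map_comp -def_w.
by apply/eq_in_map=> x /gaps_sub/eqL'.
Qed.

(** The word of t' is a weakly monotone labelling of t.  The strictly levelled
    tree to which it contracts has the same word as t', so it is t'. *)
Lemma strictly_levelled_contractions le t t' L L' : total_order le ->
  reduced t -> reduced t' -> strictly_levelled le t L -> strictly_levelled le t' L' ->
  size (gaps t) = size (gaps t') ->
  (forall i j, i < size (gaps t) -> j < size (gaps t) ->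
     le (nth 0 (map L (gaps t)) i) (nth 0 (map L (gaps t)) j) ->
     le (nth 0 (map L' (gaps t')) i) (nth 0 (map L' (gaps t')) j)) ->
  exists f, contractions t t' f.
Proof.
move=> ole rt rt' sL sL' eqsz le_w; set w' := map L' (gaps t') in le_w.
have [le_refl anti _ _] := ole.
pose M x := nth 0 w' (index x (gaps t)).
have def_w' : map M (gaps t) = w'.
  apply: (@eq_from_nth _ 0) => [|i]; first by rewrite !size_map eqsz.
  rewrite size_map => lti; rewrite (nth_map [::]) // /M.
  (* Gaps owned by the same vertex have the same letter in w': they compare
     both ways in the word of t, hence in w'. *)
  set j := index _ _.
  have eqij : nth [::] (gaps t) j = nth [::] (gaps t) i by rewrite nth_index ?mem_nth.
  have ltj : j < size (gaps t) by rewrite index_mem mem_nth.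
  by apply: anti; rewrite !le_w // !(nth_map [::]) // eqij le_refl.
have wM : weakly_levelled le t M.
  move=> x y; rewrite -!(mem_gaps_reduced rt) => xt yt pxy.
  apply: le_w; rewrite ?index_mem // !(nth_map [::]) ?index_mem // !nth_index //.
  have [->|nxy] := eqVneq x y; first exact: le_refl.
  by have /andP[] := sL x y (gaps_sub xt) (gaps_sub yt) pxy nxy.
have [t'' [f [L'' [ct sL'' eqL'']]]] := contract_to_strict ole wM.
exists f; suff <- : t'' = t' by [].
apply: (strictly_levelled_inj ole _ rt' sL'' sL'); first exact: contractions_reduced ct rt.
rewrite -/w' -def_w' -(contractions_gaps ct rt) -map_comp.
by apply/eq_in_map=> x /gaps_sub/eqL''.
Qed.

(** * Words of levelled trees *)

Lemma connect_up_edge t (v w : Vert t) :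
  connect (@up_edge t) v w = prefix (address w) (address v).
Proof.
apply/idP/idP.
  case/connectP=> p; elim: p v => [v _ ->|u p IH v /= /andP[/andP[puv _] pp] def_w].
    exact: prefix_refl.
  exact: prefix_trans (IH u pp def_w) puv.
case/prefixP=> z; elim/last_ind: z v => [v|z i IH v] def_v.
  by rewrite cats0 in def_v; rewrite (val_inj def_v : v = w) connect0.
have pt : address w ++ z \in vertices t.
  by have := ssvalP v; rewrite -/(address v) def_v -rcons_cat -cats1; apply: vertices_prefix.
apply: connect_trans (IH (SeqSub pt) erefl); apply: connect1.
by rewrite /up_edge /parent def_v -rcons_cat prefix_rcons size_rcons eqxx.
Qed.

Lemma up_precE t (v w : Vert t) :
  up_prec v w = (v != w) && prefix (address v) (address w).
Proof. by rewrite /up_prec connect_up_edge. Qed.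

Lemma down_precE t (v w : Vert t) : down_prec v w = up_prec w v.
Proof.
rewrite /down_prec /up_prec eq_sym; congr (_ && _).
exact: (connect_rev (@up_edge t) w v).
Qed.

Definition gap_vertices (t : tree) : seq (Vert t) := pmap insub (gaps t).

Lemma map_gap_vertices t : map (@address t) (gap_vertices t) = gaps t.
Proof.
rewrite /gap_vertices (pmap_filter (insubK _)).
by apply/all_filterP/allP=> x /gaps_sub xt; rewrite isSome_insub.
Qed.

Lemma mem_gap_vertices t v : reduced t -> v \in gap_vertices t.
Proof.
move=> rt; rewrite -(mem_map val_inj) [map _ _]map_gap_vertices.
by rewrite mem_gaps_reduced // (valP v).
Qed.

Lemma size_gap_vertices m (U : planar_tree m) :
  (size (gap_vertices (val U))).+1 = m.
Proof.
have /andP[rU /eqP mU] := valP U.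
by rewrite -(size_map (@address _)) map_gap_vertices size_gaps.
Qed.

Definition tree_word t h (l : Vert t -> 'I_h) : seq nat :=
  [seq l v : nat | v <- gap_vertices t].

Definition strict_levels (le : rel nat) t h (l : Vert t -> 'I_h) : Prop :=
  forall v w : Vert t, prefix (address v) (address w) -> v != w ->
  le (l v) (l w) && (l v != l w :> nat).

(** Weak inequalities suffice: equal letters of w compare both ways, so their
    counterparts in w' are equal too. *)
Definition coarsened_by (w w' : seq nat) : Prop :=
  forall i j, i < size w -> j < size w -> nth 0 w i <= nth 0 w j ->
  nth 0 w' i <= nth 0 w' j.

Lemma coarsened_by_refl w : coarsened_by w w.
Proof. by []. Qed.

Lemma coarsened_by_map (V : eqType) (a b : V -> nat) s :
  coarsened_by (map a s) (map b s) <-> {in s &, forall v w, a v <= a w -> b v <= b w}.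
Proof.
split=> [ab v w vs ws le_a|ab i j].
  have := ab (index v s) (index w s); rewrite !size_map !index_mem.
  by rewrite !(nth_map v) ?index_mem // !nth_index //; apply.
case: s ab => [//|v s] ab; rewrite !size_map => lti ltj.
by rewrite !(nth_map v) //; apply: ab; apply: mem_nth.
Qed.

Lemma coarsened_by_cat w1 w2 w1' w2' : size w1 = size w1' ->
  coarsened_by (w1 ++ w2) (w1' ++ w2') -> coarsened_by w1 w1' /\ coarsened_by w2 w2'.
Proof.
move=> eqsz ww; split=> i j lti ltj.
  have := ww i j; rewrite size_cat !nth_cat -eqsz lti ltj.
  by rewrite !(leq_trans _ (leq_addr _ _)) //; apply.
have := ww (size w1 + i) (size w1 + j); rewrite size_cat !ltn_add2l !nth_cat -eqsz.
by rewrite !ifF ?addKn; try lia; apply.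
Qed.

(** A labelling of all addresses makes sense for every tree at once, whereas l
    would have to be transported along each contraction. *)
Definition level_at t h (l : Vert t -> 'I_h) (x : seq nat) : nat :=
  if insub x is Some v then l v else 0.

Lemma level_at_address t h (l : Vert t -> 'I_h) v : level_at l (address v) = l v.
Proof. by rewrite /level_at [insub _]valK. Qed.

Lemma map_level_at t h (l : Vert t -> 'I_h) : map (level_at l) (gaps t) = tree_word l.
Proof.
by rewrite -map_gap_vertices -map_comp; apply: eq_map => v; apply: level_at_address.
Qed.

Lemma strict_levelsP le t h (l : Vert t -> 'I_h) : strict_levels le l ->
  strictly_levelled le t (level_at l).
Proof.
move=> sl x y xt yt pxy nxy.
rewrite -[x]/(address (SeqSub xt)) -[y]/(address (SeqSub yt)) !level_at_address.
exact: sl.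
Qed.

(** Thus a planar map is determined on the word: position by position, it sends
    the vertex of a gap to the vertex of the same gap. *)
Lemma planar_map_gap_vertices t t' (phi : Vert t -> Vert t') : reduced t ->
  planar_map phi -> map phi (gap_vertices t) = gap_vertices t'.
Proof.
move=> rt [f ct def_phi]; apply: (inj_map val_inj); rewrite [RHS]map_gap_vertices.
rewrite -(contractions_gaps ct rt) -map_gap_vertices -!map_comp.
by apply: eq_map => v; apply: def_phi.
Qed.

(** The planar part of a morphism.  Coarsening means the same for [leq] and
    [geq], as the two positions can be exchanged. *)
Lemma planar_map_exists le t t' h h' (l : Vert t -> 'I_h) (l' : Vert t' -> 'I_h') :
  le = leq \/ le = geq -> reduced t -> reduced t' ->
  strict_levels le l -> strict_levels le l' ->
  size (gap_vertices t) = size (gap_vertices t') ->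
  coarsened_by (tree_word l) (tree_word l') -> exists phi, @planar_map t t' phi.
Proof.
move=> le_or rt rt' /strict_levelsP sl /strict_levelsP sl' eqsz ww.
have ole := total_order_leq_geq le_or.
have [||f ct] := strictly_levelled_contractions ole rt rt' sl sl'.
- by rewrite -!map_gap_vertices !size_map.
- move=> i j; rewrite -map_gap_vertices size_map -(size_map (fun v => l v : nat)).
  rewrite map_gap_vertices !map_level_at => lti ltj.
  by case: le_or => ->; [|rewrite /geq /=]; apply: ww.
exists (fun v => SeqSub (contractions_vertices ct (valP v))); exists f => // v.
Qed.

Lemma levelled_tree_exists le w h : le = leq \/ le = geq ->
  {subset w <= iota 0 h} ->
  exists t (l : Vert t -> 'I_h), [/\ reduced t, strict_levels le l & tree_word l = w].
Proof.
move=> le_or wh.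
have ole := total_order_leq_geq le_or.
have [t [L [rt sL def_w]]] := strictly_levelled_exists w ole.
have ltL (v : Vert t) : L (address v) < h.
  have : L (address v) \in w by rewrite -def_w map_f // mem_gaps_reduced // (valP v).
  by move/wh; rewrite mem_iota.
exists t, (fun v => Ordinal (ltL v)); split=> // [v v' pvv' nvv'|].
  exact: (sL _ _ (valP v) (valP v')).
by rewrite /tree_word -def_w -map_gap_vertices -map_comp.
Qed.

(** The part of a morphism on levels: l being onto, the coarsening of words is
    induced by a map between levels. *)
Lemma order_preserving_factor (V : finType) (s : seq V) h h' (l : V -> 'I_h)
    (g : V -> 'I_h') : (forall v, v \in s) -> (forall i, exists v, l v = i) ->
  coarsened_by [seq l v : nat | v <- s] [seq g v : nat | v <- s] ->
  exists2 hat, order_preserving hat & forall v, g v = hat (l v).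
Proof.
move=> sV l_onto /coarsened_by_map lg; have [r rK] := choice l_onto.
exists (g \o r) => [i j le_ij|v]; first by apply: lg; rewrite ?rK.
by apply/val_inj/eqP; rewrite eqn_leq !lg ?rK.
Qed.

(** * Trees with levels *)

Definition lT_word m (X : lT m) : seq nat := tree_word (lT_l X).

Lemma strict_levels_up t h (l : Vert t -> 'I_h) :
  strict_levels leq l <-> forall v w, up_prec v w -> l v < l w.
Proof.
split=> sl v w.
  by rewrite up_precE => /andP[nvw pvw]; rewrite ltn_neqAle andbC sl.
by move=> pvw nvw; rewrite andbC -ltn_neqAle sl // up_precE pvw andbT.
Qed.

Lemma strict_levels_down t h (l : Vert t -> 'I_h) :
  strict_levels geq l <-> forall v w, down_prec v w -> l v < l w.
Proof.
split=> sl v w.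
  rewrite down_precE up_precE => /andP[nvw pvw].
  by rewrite ltn_neqAle andbC eq_sym; apply: sl.
by move=> pvw nvw; rewrite andbC eq_sym -ltn_neqAle sl // down_precE up_precE pvw andbT.
Qed.

Lemma reduced_planar_tree m (U : planar_tree m) : reduced (val U).
Proof. by have /andP[] := valP U. Qed.

Lemma levelsP (V : finType) (prec : rel V) h (l : {ffun V -> 'I_h}) :
  levels prec l <->
  (forall i, exists v, l v = i) /\ (forall v w, prec v w -> l v < l w).
Proof.
split=> [/andP[/forallP onto /forallP mono]|[onto mono]].
  split=> [i|v w]; first by have /existsP[v /eqP] := onto i; exists v.
  by have /forallP/(_ w)/implyP := mono v.
apply/andP; split; first by apply/forallP=> i; apply/existsP; have [v <-] := onto i; exists v.
by apply/forallP=> v; apply/forallP=> w; apply/implyP/mono.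
Qed.

Lemma mem_word (V : finType) (s : seq V) h (l : V -> 'I_h) : (forall v, v \in s) ->
  (forall i, exists v, l v = i) <-> [seq l v : nat | v <- s] =i iota 0 h.
Proof.
move=> sV; split=> [onto k|def_w i].
  rewrite mem_iota /=; apply/mapP/idP=> [[v _ -> //]|ltk].
  by have [v def_v] := onto (Ordinal ltk); exists v; rewrite ?def_v.
have := def_w i; rewrite mem_iota ltn_ord => /mapP[v _ def_i].
by exists v; apply: val_inj.
Qed.

Lemma order_preserving_coarsened (V : eqType) (s : seq V) h h' (l : V -> 'I_h)
    (g : V -> 'I_h') hat : order_preserving hat -> (forall v, g v = hat (l v)) ->
  coarsened_by [seq l v : nat | v <- s] [seq g v : nat | v <- s].
Proof.
by move=> mono def_g; apply/coarsened_by_map=> v w _ _ le_vw; rewrite !def_g; apply: mono.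
Qed.

Lemma size_lT_word m (X : lT m) : (size (lT_word X)).+1 = m.
Proof. by rewrite size_map size_gap_vertices. Qed.

Lemma lT_word_onto m (X : lT m) : lT_word X =i iota 0 (lT_h X).
Proof.
have [onto _] := (levelsP _ _).1 (lT_levels X).
by apply/mem_word=> // v; apply/mem_gap_vertices/reduced_planar_tree.
Qed.

Lemma lT_le_word m (X Y : lT m) :
  lT_le X Y <-> coarsened_by (lT_word X) (lT_word Y).
Proof.
have [rX rY] := (reduced_planar_tree (lT_U X), reduced_planar_tree (lT_U Y)).
have [ontoX sX] := (levelsP _ _).1 (lT_levels X).
have [_ sY] := (levelsP _ _).1 (lT_levels Y).
have word_Y phi : planar_map phi ->
    lT_word Y = [seq lT_l Y (phi v) : nat | v <- gap_vertices (val (lT_U X))].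
  by move=> pm; rewrite /lT_word /tree_word -(planar_map_gap_vertices rX pm) -map_comp.
split=> [[phi [hat [pm mono eq_l]]]|XY].
  by rewrite (word_Y phi) //; apply: order_preserving_coarsened mono eq_l.
have [||||phi pm] := @planar_map_exists leq _ _ _ _ (lT_l X) (lT_l Y) _ rX rY _ _ _ XY.
- by left.
- exact/strict_levels_up.
- exact/strict_levels_up.
- by apply: succn_inj; rewrite !size_gap_vertices.
move: XY; rewrite (word_Y phi pm) => XY.
have [v|hat mono eq_l] := order_preserving_factor _ ontoX XY.
  exact: mem_gap_vertices.
by exists phi, hat.
Qed.

Lemma lT_word_exists m h (w : seq nat) : (size w).+1 = m -> w =i iota 0 h ->
  exists X : lT m, lT_word X = w.
Proof.
move=> szw onto_w; have [|k|t [l [rt sl def_w]]] := @levelled_tree_exists leq w h.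
- by left.
- by rewrite onto_w.
have tP : reduced t && (nleaves t == m).
  by rewrite rt -size_gaps // -map_gap_vertices size_map -szw -def_w size_map eqxx.
have lP : levels (@up_prec t) (finfun l).
  apply/levelsP; split.
    apply/(@mem_word _ (gap_vertices t)) => [v|]; first exact: mem_gap_vertices.
    by move=> k; rewrite -onto_w -def_w; congr (k \in _); apply: eq_map => v; rewrite ffunE.
  by move=> v w' /((strict_levels_up l).1 sl); rewrite !ffunE.
exists (@LT m (exist _ t tP) h (finfun l) lP); rewrite -def_w.
by apply: eq_map => v; rewrite /= ffunE.
Qed.

(** * Complementary pairs *)

Definition clT_vertices m n (Y : clT m n) :
    seq (Vert (val (clT_U Y)) + Vert (val (clT_D Y))) :=
  map inl (gap_vertices (val (clT_U Y))) ++ map inr (gap_vertices (val (clT_D Y))).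

Definition clT_word m n (Y : clT m n) : seq nat :=
  [seq clT_l Y v : nat | v <- clT_vertices Y].

Lemma mem_clT_vertices m n (Y : clT m n) v : v \in clT_vertices Y.
Proof.
rewrite mem_cat; case: v => v.
  by rewrite map_f // mem_gap_vertices // reduced_planar_tree.
by rewrite [X in _ || X]map_f ?orbT // mem_gap_vertices // reduced_planar_tree.
Qed.

Lemma clT_wordE m n (Y : clT m n) :
  clT_word Y = tree_word (fun v => clT_l Y (inl v)) ++ tree_word (fun v => clT_l Y (inr v)).
Proof. by rewrite /clT_word map_cat -!map_comp. Qed.

Lemma size_clT_word m n (Y : clT m n) : (size (clT_word Y)).+2 = m + n.
Proof. by rewrite clT_wordE size_cat !size_map -addSn -addnS !size_gap_vertices. Qed.

Lemma clT_word_onto m n (Y : clT m n) : clT_word Y =i iota 0 (clT_h Y).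
Proof.
have [onto _] := (levelsP _ _).1 (clT_levels Y).
by apply/mem_word=> // v; apply: mem_clT_vertices.
Qed.

(** Coarsening restricts to each of the two parts of the words, which gives the
    two planar maps; the map on levels comes from the whole words. *)
Lemma clT_le_word m n (X Y : clT m n) :
  clT_le X Y <-> coarsened_by (clT_word X) (clT_word Y).
Proof.
have [rUX rUY] := (reduced_planar_tree (clT_U X), reduced_planar_tree (clT_U Y)).
have [rDX rDY] := (reduced_planar_tree (clT_D X), reduced_planar_tree (clT_D Y)).
have [ontoX sX] := (levelsP _ _).1 (clT_levels X).
have [_ sY] := (levelsP _ _).1 (clT_levels Y).
have word_Y phiu phid : planar_map phiu -> planar_map phid ->
    clT_word Y = [seq clT_l Y (sum_map phiu phid v) : nat | v <- clT_vertices X].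
  move=> pu pd; rewrite clT_wordE map_cat -!map_comp /tree_word.
  by rewrite -(planar_map_gap_vertices rUX pu) -(planar_map_gap_vertices rDX pd) -!map_comp.
split=> [[phiu [phid [hat [pu pd mono eq_l]]]]|XY].
  by rewrite (word_Y phiu phid) //; apply: order_preserving_coarsened mono eq_l.
have := XY; rewrite !clT_wordE => /coarsened_by_cat[|XYu XYd].
  by apply: succn_inj; rewrite !size_map !size_gap_vertices.
have [|||phiu pu] := planar_map_exists (or_introl erefl) rUX rUY _ _ _ XYu.
- by apply/strict_levels_up=> v w ?; apply: sX.
- by apply/strict_levels_up=> v w ?; apply: sY.
- by apply: succn_inj; rewrite !size_gap_vertices.
have [|||phid pd] := planar_map_exists (or_intror erefl) rDX rDY _ _ _ XYd.
- by apply/strict_levels_down=> v w ?; apply: sX.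
- by apply/strict_levels_down=> v w ?; apply: sY.
- by apply: succn_inj; rewrite !size_gap_vertices.
move: XY; rewrite (word_Y phiu phid pu pd) => XY.
have [v|hat mono eq_l] := order_preserving_factor _ ontoX XY.
  exact: mem_clT_vertices.
by exists phiu, phid, hat.
Qed.

(** The first m - 1 letters are the gaps of U, the other ones those of D. *)
Lemma clT_word_exists m n h (w : seq nat) : 0 < m -> 0 < n -> (size w).+2 = m + n ->
  w =i iota 0 h -> exists Y : clT m n, clT_word Y = w.
Proof.
move=> m_gt0 n_gt0 szw onto_w.
have [|k kw|U [lU [rU sU def_u]]] := @levelled_tree_exists leq (take m.-1 w) h.
- by left.
- by rewrite -onto_w (mem_take kw).
have [|k kw|D [lD [rD sD def_d]]] := @levelled_tree_exists geq (drop m.-1 w) h.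
- by right.
- by rewrite -onto_w (mem_drop kw).
have UP : reduced U && (nleaves U == m).
  rewrite rU -size_gaps // -map_gap_vertices size_map -(size_map (fun v => lU v : nat)).
  by rewrite [map _ _]def_u size_takel ?prednK ?eqxx //; lia.
have DP : reduced D && (nleaves D == n).
  rewrite rD -size_gaps // -map_gap_vertices size_map -(size_map (fun v => lD v : nat)).
  by rewrite [map _ _]def_d size_drop; apply/eqP; lia.
pose l : {ffun (Vert U + Vert D)%type -> 'I_h} :=
  [ffun v => match v with inl u => lU u | inr d => lD d end].
have def_w : [seq l v : nat | v <- map inl (gap_vertices U) ++ map inr (gap_vertices D)] = w.
  rewrite map_cat -!map_comp -[RHS](cat_take_drop m.-1) -def_u -def_d.
  by congr (_ ++ _); apply: eq_map => v; rewrite /= ffunE.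
have lP : levels (@pair_prec U D) l.
  apply/levelsP; split.
    apply/mem_word; last by move=> k; rewrite -onto_w -[in RHS]def_w.
    rewrite /= => v; rewrite mem_cat; case: v => v.
      by rewrite map_f // mem_gap_vertices.
    by rewrite [X in _ || X]map_f ?orbT // mem_gap_vertices.
  case=> v [] v' //=; rewrite !ffunE.
    exact: (strict_levels_up lU).1 sU v v'.
  exact: (strict_levels_down lD).1 sD v v'.
by exists (@CLT m n (exist _ U UP) (exist _ D DP) h l lP).
Qed.

(** * The isomorphism *)

(** Each object is sent to the one with the same word.  The two maps are mutually
    inverse by antisymmetry, objects with equal words being comparable both
    ways. *)
Theorem theorem1p2p1 (m n : nat) (m_ge1 : 1 <= m) (n_ge1 : 1 <= n) :
  exists f : lT (m + n - 1) -> clT m n, poset_isomorphism f.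
Proof.
have f_ex (X : lT (m + n - 1)) : exists Y : clT m n, clT_word Y = lT_word X.
  apply: clT_word_exists (@lT_word_onto _ X) => //.
  by have := size_lT_word X; lia.
have g_ex (Y : clT m n) : exists X : lT (m + n - 1), lT_word X = clT_word Y.
  apply: lT_word_exists (@clT_word_onto _ _ Y).
  by have := size_clT_word Y; lia.
have [[f fE] [g gE]] := (choice f_ex, choice g_ex).
exists f; split.
  exists g => [X|Y].
    by apply: lT_le_anti; apply/lT_le_word; rewrite gE fE; apply: coarsened_by_refl.
  by apply: clT_le_anti; apply/clT_le_word; rewrite fE gE; apply: coarsened_by_refl.
move=> X Y; apply/clT_leP/lT_leP; first by move/clT_le_word; rewrite !fE => /lT_le_word.
by move/lT_le_word => XY; apply/clT_le_word; rewrite !fE.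
Qed.
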